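(* Let $W$ be a finite-dimensional real vector space, let $\varphi$ be a nondegenerate symmetric bilinear form on $W$, let $k\ge 1$, and suppose $(V,R)=\bigoplus_{i=1}^k (W,R_\varphi)$ with $\ker R=0$. Then $G_R$ is isomorphic to the wreath product $G_{R_\varphi}\wr S_k$.
   Context: For a symmetric bilinear form $\varphi$, $R_\varphi(x,y,z,w)=\varphi(x,w)\varphi(y,z)-\varphi(x,z)\varphi(y,w)$. $(V,R)=\bigoplus_{i=1}^k (W,R_\varphi)$ means that $V=W\oplus\cdots\oplus W$ ($k$ copies) and $R(x,y,z,w)=\sum_{i=1}^k R_\varphi(x_i,y_i,z_i,w_i)$, where $x=(x_1,\dots,x_k)$, etc. $\ker R=\{v\in V: R(v,x,y,z)=0\ \text{for all } x,y,z\in V\}$. For a 4-linear form $T$ on a vector space $U$, $G_T=\{A\in GL(U): T(Ax,Ay,Az,Aw)=T(x,y,z,w)\ \text{for all } x,y,z,w\in U\}$. For a group $G$, $G\wr S_k$ is the semidirect product $G^k\rtimes S_k$ with multiplication $(h_1,\dots,h_k;\tau)(g_1,\dots,g_k;\sigma)=(h_1g_{\tau^{-1}(1)},\dots,h_kg_{\tau^{-1}(k)};\tau\sigma)$, where $S_k$ is the symmetric group on $\{1,\dots,k\}$.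
   Formalization: The formal theorem additionally assumes that W is nonzero; for W = 0 and k ≥ 2 the kernel of R is 0 and G_R is trivial, but the wreath product is S_k, so the claim fails. *)

(* Defs.v *)
From HB Require Import structures.
From mathcomp Require Import all_boot all_order all_fingroup all_algebra.
From mathcomp Require Import boolp classical_sets reals.

Set Implicit Arguments.
Unset Strict Implicit.
Unset Printing Implicit Defensive.

Import GRing.Theory.

Local Open Scope ring_scope.

Section GeneralLinearGroup.
Variables (F : fieldType) (U : vectType F).

(* U is finite-dimensional, so a trivial kernel means invertible. *)
Record GL := MkGL { GLval :> 'End(U); _ : lker GLval == 0%VS }.

HB.instance Definition _ := [isSub for GLval].
HB.instance Definition _ := [Choice of GL by <:].

Lemma GL_ker (A : GL) : lker A == 0%VS.
Proof. by case: A. Qed.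

Fact GL_one_subproof : lker (\1%VF : 'End(U)) == 0%VS.
Proof. by apply/lker0P => x y; rewrite !id_lfunE. Qed.

Fact GL_mul_subproof (A B : GL) : lker (A \o B)%VF == 0%VS.
Proof.
apply/lker0P => x y; rewrite !comp_lfunE.
by move=> /(lker0P (GL_ker A)) /(lker0P (GL_ker B)).
Qed.

Fact GL_inv_subproof (A : GL) : lker (A^-1)%VF == 0%VS.
Proof.
by apply/lker0P; apply: (can_inj (g := A)); exact: lker0_lfunVK (GL_ker A).
Qed.

Definition GL_one : GL := MkGL GL_one_subproof.
Definition GL_mul (A B : GL) : GL := MkGL (GL_mul_subproof A B).
Definition GL_inv (A : GL) : GL := MkGL (GL_inv_subproof A).

Fact GL_mulA : associative GL_mul.
Proof. by move=> A B C; apply: val_inj; exact: comp_lfunA. Qed.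

Fact GL_1mul : left_id GL_one GL_mul.
Proof. by move=> A; apply: val_inj; exact: comp_lfun1l. Qed.

Fact GL_mul1 : right_id GL_one GL_mul.
Proof. by move=> A; apply: val_inj; exact: comp_lfun1r. Qed.

Fact GL_Vmul : left_inverse GL_one GL_inv GL_mul.
Proof. by move=> A; apply: val_inj; exact: lker0_compVf (GL_ker A). Qed.

Fact GL_mulV : right_inverse GL_one GL_inv GL_mul.
Proof. by move=> A; apply: val_inj; exact: lker0_compfV (GL_ker A). Qed.

HB.instance Definition _ :=
  isGroup.Build GL GL_mulA GL_1mul GL_mul1 GL_Vmul GL_mulV.

End GeneralLinearGroup.

(* Multilinearity is not imposed: it holds for the forms defined below, and
   the invariance group and the kernel make sense without it. *)
Definition form4 (F : fieldType) (U : vectType F) := U -> U -> U -> U -> F.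

Section StructureGroup.
Variables (F : fieldType) (U : vectType F) (T : form4 U).

Definition preserves : pred (GL U) := fun A =>
  `[< forall x y z w, T (A x) (A y) (A z) (A w) = T x y z w >].

Record structure_group := MkStructureGroup { strval :> GL U; _ : preserves strval }.

HB.instance Definition _ := [isSub for strval].
HB.instance Definition _ := [Choice of structure_group by <:].

Fact preserves_group_closed : group_closed preserves.
Proof.
split=> [|A B /asboolP TA /asboolP TB]; apply/asboolP => x y z w.
  by rewrite !id_lfunE.
have BK u : B (inv_lfun B u) = u by exact: lker0_lfunVK (GL_ker B) u.
by rewrite !comp_lfunE TA -TB !BK.
Qed.

HB.instance Definition _ :=
  SubChoice_isSubGroup.Build (GL U) preserves structure_group preserves_group_closed.

Definition ker_form : set U := [set v | forall x y z, T v x y z = 0]%classic.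

End StructureGroup.

Section CurvatureModel.
Variables (F : fieldType) (W : vectType F).

Definition curvature_form (phi : {symmetric W}) : form4 W := fun x y z w =>
  phi x w * phi y z - phi x z * phi y w.

Definition direct_sum_form (k : nat) (T : form4 W) : form4 {ffun 'I_k -> W} :=
  fun x y z w => \sum_(i < k) T (x i) (y i) (z i) (w i).

End CurvatureModel.
Arguments direct_sum_form {F W} k T.

Section WreathProduct.
Variables (G : groupType) (k : nat).
Local Open Scope group_scope.

Definition wreath : Type := ({ffun 'I_k -> G} * 'S_k)%type.

HB.instance Definition _ := Choice.on wreath.

Definition wreath_one : wreath := ([ffun=> 1], 1).

(* Permutations compose from left to right in MathComp, (s * t) i = t (s i),
   so the composite tau o sigma of the usual convention is q.2 * p.2. *)
Definition wreath_mul (p q : wreath) : wreath :=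
  ([ffun i => p.1 i * q.1 (p.2^-1 i)], q.2 * p.2).

Definition wreath_inv (p : wreath) : wreath :=
  ([ffun i => (p.1 (p.2 i))^-1], p.2^-1).

Fact wreath_mulA : associative wreath_mul.
Proof.
move=> p q r; congr pair; last by rewrite /= mulgA.
by apply/ffunP => i; rewrite !ffunE /= invMg permM mulgA.
Qed.

Fact wreath_1mul : left_id wreath_one wreath_mul.
Proof.
case=> f s; congr pair; last by rewrite /= mulg1.
by apply/ffunP => i; rewrite !ffunE /= invg1 perm1 mul1g.
Qed.

Fact wreath_mul1 : right_id wreath_one wreath_mul.
Proof.
case=> f s; congr pair; last by rewrite /= mul1g.
by apply/ffunP => i; rewrite !ffunE mulg1.
Qed.

Fact wreath_Vmul : left_inverse wreath_one wreath_inv wreath_mul.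
Proof.
case=> f s; congr pair; last by rewrite /= mulgV.
by apply/ffunP => i; rewrite !ffunE /= invgK mulVg.
Qed.

Fact wreath_mulV : right_inverse wreath_one wreath_inv wreath_mul.
Proof.
case=> f s; congr pair; last by rewrite /= mulVg.
by apply/ffunP => i; rewrite !ffunE /= permKV mulgV.
Qed.

HB.instance Definition _ :=
  isGroup.Build wreath wreath_mulA wreath_1mul wreath_mul1
    wreath_Vmul wreath_mulV.

End WreathProduct.

Definition isomorphic_groups (G H : groupType) : Prop :=
  exists f : {multiplicative G -> H}, bijective f.

(* Main.v *)
Require Import Defs.
From HB Require Import structures.
From mathcomp Require Import all_boot all_order all_fingroup all_algebra.
From mathcomp Require Import boolp classical_sets reals.

(** Write R for the form on V = W^k and, for x in V, let Z(x) be the set of the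
    v with R(x, v, _, _) = 0.  Since R is a sum over the k blocks, v belongs to
    Z(x) exactly when every (x_i, v_i) satisfies R_phi(x_i, v_i, _, _) = 0, and
    nondegeneracy of phi turns this into linear dependence of x_i and v_i
    ([null_pair_collinear]).

    The relation v in Z(x) is invariant under G_R, and it detects the blocks.  If
    x is a vector w of a single block, every y with Z(x) included in Z(y) is a
    multiple of x ([null_pairs_embed_sub]): y has no component in another block,
    because ker R = 0, and x itself lies in Z(x).  On the other hand Z(x) grows
    when x is replaced by one of its components.  Transporting this through an A
    in G_R, each component of A x is a multiple of A x, so A x lies in a single
    block again ([embed_image_supp]).  By linearity the target block depends only
    on the block of x, and comparing with A^-1 shows that A permutes the blocks
    ([blocks_permuted]).

    Hence every A in G_R consists of a permutation of the blocks followed by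
    one element of G_{R_phi} in each block.  That is, the obvious action of the
    wreath product on V ([wreath_act]), which preserves the direct sum of any
    form, is onto G_R ([wreath_act_surj]); it is faithful as soon as W is nonzero
    ([wreath_act_inj]). *)

Set Implicit Arguments.
Unset Strict Implicit.
Unset Printing Implicit Defensive.

Import GRing.Theory.

Local Open Scope ring_scope.

(** * Groups of invertible maps *)

Lemma isomorphic_groups_inv (G H : groupType) (f : H -> G) :
    {morph f : x y / (x * y)%g} -> injective f -> (forall y, exists x, f x = y) ->
  isomorphic_groups G H.
Proof.
move=> fM f_inj f_surj.
have [g fgK] := choice f_surj.
have gfK : cancel f g by move=> x; apply: f_inj; rewrite fgK.
have gM : {morph g : x y / (x * y)%g} by move=> x y; apply: f_inj; rewrite fM !fgK.
pose gMult := isMultiplicative.Build G H g gM.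
by exists (HB.pack g gMult : {multiplicative G -> H}), f.
Qed.

Section StructureGroupTheory.
Variables (F : fieldType) (U : vectType F) (T : form4 U).
Implicit Types A B : structure_group T.

Lemma structure_group_preserves A x y z w : T (A x) (A y) (A z) (A w) = T x y z w.
Proof. by case: A => A /= /asboolP. Qed.

Lemma structure_group_mulE A B x : (A * B)%g x = A (B x).
Proof. by rewrite -comp_lfunE. Qed.

Lemma structure_group_oneE x : (1%g : structure_group T) x = x.
Proof. exact: id_lfunE. Qed.

Lemma structure_groupK A x : (A^-1)%g (A x) = x.
Proof. by rewrite -structure_group_mulE mulVg structure_group_oneE. Qed.

Lemma structure_groupVK A x : A ((A^-1)%g x) = x.
Proof. by rewrite -structure_group_mulE mulgV structure_group_oneE. Qed.

Lemma structure_group_eq0 A x : (A x == 0) = (x == 0).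
Proof.
apply/eqP/eqP => [Ax0|->]; last exact: linear0.
by rewrite -(structure_groupK A x) Ax0 linear0.
Qed.

Lemma structure_group_ext A B : (forall x, A x = B x) -> A = B.
Proof. by move=> AB; apply/val_inj/val_inj/lfunP. Qed.

(** For a curvature tensor T, the curvature operator at x, y vanishes. *)
Definition null_pair (x y : U) := forall z w, T x y z w = 0.

Lemma null_pair_act A x y : null_pair (A x) (A y) <-> null_pair x y.
Proof.
split=> N z w; first by rewrite -(structure_group_preserves A).
by rewrite -(structure_groupVK A z) -(structure_groupVK A w) structure_group_preserves.
Qed.

End StructureGroupTheory.

(** * The action of the wreath product on a direct sum *)

Section Embed.
Variables (F : fieldType) (W : vectType F) (k : nat).

Definition embed (i : 'I_k) (w : W) : {ffun 'I_k -> W} :=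
  [ffun j => if j == i then w else 0].

Lemma embed_id i w : embed i w i = w.
Proof. by rewrite ffunE eqxx. Qed.

Lemma embed_neq i j w : j != i -> embed i w j = 0.
Proof. by rewrite ffunE => /negbTE->. Qed.

Fact embed_is_linear i : linear (embed i).
Proof.
move=> a u v; apply/ffunP => j; rewrite !ffunE.
by case: ifP => // _; rewrite scaler0 addr0.
Qed.

HB.instance Definition _ i :=
  GRing.isLinear.Build F W {ffun 'I_k -> W} _ (embed i) (embed_is_linear i).

Lemma ffun_sum_embed (x : {ffun 'I_k -> W}) : x = \sum_i embed i (x i).
Proof.
apply/ffunP => j; rewrite sum_ffunE (bigD1 j) //= embed_id big1 ?addr0 // => i ij.
by rewrite embed_neq // eq_sym.
Qed.

End Embed.

Section WreathAction.
Variables (F : fieldType) (W : vectType F) (T : form4 W) (k : nat).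
Local Notation V := {ffun 'I_k -> W}.
Local Notation RV := (direct_sum_form k T).
Local Notation wr := (wreath (structure_group T) k).

Definition wreath_fun (p : wr) (x : V) : V := [ffun i => p.1 i (x (p.2^-1%g i))].

Fact wreath_fun_is_linear p : linear (wreath_fun p).
Proof. by move=> a x y; apply/ffunP => i; rewrite !ffunE linearP. Qed.

HB.instance Definition _ p :=
  GRing.isLinear.Build F V V _ (wreath_fun p) (wreath_fun_is_linear p).

Fact wreath_fun_ker p : lker (linfun (wreath_fun p)) == 0%VS.
Proof.
apply/lker0P => x y; rewrite !lfunE => /ffunP xy; apply/ffunP => i.
have := xy (p.2 i); rewrite !ffunE permK => /(congr1 ((p.1 (p.2 i))^-1)%g).
by rewrite !structure_groupK.
Qed.

Definition wreath_GL p : GL V := MkGL (wreath_fun_ker p).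

Lemma wreath_GLE p x i : wreath_GL p x i = p.1 i (x (p.2^-1%g i)).
Proof. by rewrite lfunE /= ffunE. Qed.

Fact wreath_GL_preserves p : preserves RV (wreath_GL p).
Proof.
apply/asboolP => x y z w; rewrite /direct_sum_form.
rewrite [RHS](reindex_inj (@perm_inj _ (p.2^-1)%g)); apply: eq_bigr => i _.
by rewrite !wreath_GLE structure_group_preserves.
Qed.

Definition wreath_act p : structure_group RV := MkStructureGroup (wreath_GL_preserves p).

Lemma wreath_actE p x i : wreath_act p x i = p.1 i (x (p.2^-1%g i)).
Proof. exact: wreath_GLE. Qed.

Lemma wreath_actM : {morph wreath_act : p q / (p * q)%g}.
Proof.
move=> p q; apply: structure_group_ext => x; apply/ffunP => i.
rewrite structure_group_mulE !wreath_actE /= ffunE structure_group_mulE.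
by rewrite invMg permM.
Qed.

Lemma wreath_act_inj (w0 : W) : w0 != 0 -> injective wreath_act.
Proof.
move=> w0_neq0 [f s] [g t] fg.
have E (x : V) i : f i (x (s^-1%g i)) = g i (x (t^-1%g i)).
  by rewrite -(wreath_actE (f, s)) fg wreath_actE.
have st : s = t.
  apply: invg_inj; apply/permP => i; apply/eqP/negPn/negP => st_i.
  have /eqP := E (embed (s^-1%g i) w0) i.
  rewrite embed_id [embed _ _ _]embed_neq 1?[_ == s^-1%g i]eq_sym //.
  by rewrite linear0 structure_group_eq0 (negbTE w0_neq0).
rewrite -st in E *; congr pair; apply/ffunP => i.
by apply: structure_group_ext => w; have := E (embed (s^-1%g i) w) i; rewrite embed_id.
Qed.

End WreathAction.

(** * Null pairs of a direct sum of curvature forms *)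

Section NullPairs.
Variables (F : fieldType) (W : vectType F) (phi : {symmetric W}) (k : nat).
Local Notation V := {ffun 'I_k -> W}.
Local Notation T := (curvature_form phi).
Local Notation RV := (direct_sum_form k T).

Lemma nondegenerate_eq0 u : nondegenerate phi -> (forall v, phi u v = 0) -> u = 0.
Proof.
move=> /eqP phi_nd u0; apply/eqP; rewrite -memv0 -phi_nd.
by apply/mem_orthovP => v _; rewrite u0.
Qed.

(** Choosing b with phi(w, b) <> 0, the vanishing of T(y, w, _, b) says that y
    and a multiple of w have the same products with every vector. *)
Lemma null_pair_collinear y w : nondegenerate phi -> w != 0 ->
  null_pair T y w -> exists c, y = c *: w.
Proof.
move=> phi_nd w_neq0 N.
have [b wb] : exists b, phi w b != 0.
  apply: contrapT => /forallNP w0; move/eqP: w_neq0; apply.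
  by apply: nondegenerate_eq0 => // b; apply/eqP/negPn/negP/w0.
exists (phi y b / phi w b); apply/eqP; rewrite -subr_eq0; apply/eqP.
apply: nondegenerate_eq0 => // a.
have := N a b; rewrite /curvature_form => /subr0_eq yw.
by rewrite linearBl linearZl_LR /= mulrAC yw mulfK ?subrr.
Qed.

Lemma curvature_form_diag x : null_pair T x x.
Proof. by move=> z w; rewrite /curvature_form mulrC subrr. Qed.

Lemma curvature_form0l y z w : T 0 y z w = 0.
Proof. by rewrite /curvature_form !linear0l !mul0r subrr. Qed.

Lemma curvature_form0r y z w : T z w y 0 = 0.
Proof. by rewrite /curvature_form !linear0r mulr0 mul0r subrr. Qed.

Lemma direct_sum_form_embed i w y z u : RV (embed i w) y z u = T w (y i) (z i) (u i).
Proof.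
rewrite /direct_sum_form (bigD1 i) //= embed_id big1 ?addr0 // => j ij.
by rewrite embed_neq ?curvature_form0l.
Qed.

Lemma null_pair_direct_sum (x y : V) :
  null_pair RV x y <-> forall i, null_pair T (x i) (y i).
Proof.
split=> N; last by move=> z w; rewrite /direct_sum_form big1 // => i _; apply: N.
move=> i z w; have := N (embed i z) (embed i w).
rewrite /direct_sum_form (bigD1 i) //= !embed_id big1 ?addr0 // => j ij.
by rewrite (embed_neq w) // curvature_form0r.
Qed.

End NullPairs.

(** * The structure group permutes the blocks *)

Section Blocks.
Variables (F : fieldType) (W : vectType F) (phi : {symmetric W}) (k : nat).
Local Notation V := {ffun 'I_k -> W}.
Local Notation T := (curvature_form phi).
Local Notation RV := (direct_sum_form k T).
Hypothesis phi_nd : nondegenerate phi.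
Hypothesis RV_ker : ker_form RV = [set 0]%classic.
Implicit Type A : structure_group RV.

Lemma summand_ker_eq0 (i : 'I_k) (y : W) : (forall z, null_pair T y z) -> y = 0.
Proof.
move=> N; have : ker_form RV (embed i y).
  by move=> a b c; rewrite direct_sum_form_embed; apply: N.
by rewrite RV_ker => /(congr1 (fun x : V => x i)); rewrite embed_id ffunE.
Qed.

(** Two kinds of test vectors suffice: those of the other blocks, which leave y
    only its component i, and embed i w itself, which makes that component a
    multiple of w. *)
Lemma null_pairs_embed_sub i w (y : V) : w != 0 ->
    (forall v, null_pair RV (embed i w) v -> null_pair RV y v) ->
  exists c, y = c *: embed i w.
Proof.
move=> w_neq0 sub_y.
have yj j : j != i -> y j = 0.
  move=> ji; apply: (summand_ker_eq0 j) => z.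
  have /sub_y /null_pair_direct_sum /(_ j) : null_pair RV (embed i w) (embed j z).
    move=> a b; rewrite direct_sum_form_embed embed_neq 1?eq_sym //.
    by rewrite /curvature_form !linear0l mulr0 mulr0 subrr.
  by rewrite embed_id.
have [c yi] : exists c, y i = c *: w.
  apply: (null_pair_collinear phi_nd w_neq0).
  have /sub_y /null_pair_direct_sum /(_ i) : null_pair RV (embed i w) (embed i w).
    by apply/null_pair_direct_sum => j; apply: curvature_form_diag.
  by rewrite embed_id.
exists c; apply/ffunP => j; rewrite !ffunE.
by case: eqP => [->|/eqP ji]; rewrite ?yi ?scaler0 ?yj.
Qed.

(** The component y of A x in one block satisfies Z(A x) in Z(y), hence Z(x) in
    Z(A^-1 y), which makes y a multiple of A x.  A second nonzero component of
    A x would force that multiple to vanish. *)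
Lemma embed_image_supp A i w j l :
  A (embed i w) j != 0 -> A (embed i w) l != 0 -> j = l.
Proof.
have [->|w_neq0] := eqVneq w 0; first by rewrite !linear0 ffunE eqxx.
set x := A _ => xj xl; apply/eqP/negPn/negP => jl.
pose y := embed j (x j).
have [v Zv|c yE] := @null_pairs_embed_sub i w ((A^-1)%g y) w_neq0.
  rewrite -(structure_groupK A v); apply/null_pair_act/null_pair_direct_sum => m.
  have /null_pair_direct_sum/(_ m) Nm : null_pair RV x (A v) by apply/null_pair_act.
  rewrite /y ffunE; case: eqP => [<-|_] a b; [exact: Nm | exact: curvature_form0l].
have {}yE : y = c *: x by rewrite -(structure_groupVK A y) yE linearZ.
have /eqP := congr1 (fun u : V => u l) yE.
rewrite embed_neq; last by rewrite eq_sym.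
rewrite ffunE eq_sym scaler_eq0 (negbTE xl) orbF => /eqP c0.
have := congr1 (fun u : V => u j) yE; rewrite embed_id c0 scale0r ffunE.
by move/eqP; apply/negP.
Qed.

Definition maps_block A i j := forall w l, l != j -> A (embed i w) l = 0.

(** If A mapped two vectors of the block i to different blocks, their sum would
    have an image with two nonzero components. *)
Lemma maps_block_exists A i (w0 : W) : w0 != 0 -> exists j, maps_block A i j.
Proof.
move=> w0_neq0.
have [j x0j] : exists j, A (embed i w0) j != 0.
  apply: contrapT => /forallNP x0; have /eqP : A (embed i w0) = 0.
    by apply/ffunP => j; rewrite ffunE; apply/eqP/negPn/negP/x0.
  rewrite structure_group_eq0 => /eqP/(congr1 (fun x : V => x i)).
  by rewrite embed_id ffunE; move/eqP; apply/negP.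
exists j => w l lj; apply/eqP/negPn/negP => xl.
have x0l : A (embed i w0) l = 0.
  by apply/eqP/negPn/negP => /(embed_image_supp x0j) /eqP; rewrite eq_sym (negbTE lj).
have xj : A (embed i w) j = 0.
  by apply/eqP/negPn/negP => /(embed_image_supp xl) /eqP; rewrite (negbTE lj).
have : j = l.
  by apply: (@embed_image_supp A i (w0 + w));
    rewrite !linearD ffunE ?xj ?x0l ?addr0 ?add0r.
by move/eqP; rewrite eq_sym (negbTE lj).
Qed.

Lemma maps_block_embed A i j w :
  maps_block A i j -> A (embed i w) = embed j (A (embed i w) j).
Proof. by move=> Aij; apply/ffunP => l; rewrite [RHS]ffunE; case: eqP => [->//|/eqP/Aij]. Qed.

Lemma maps_blockV A i j i' (w0 : W) : w0 != 0 ->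
  maps_block A i j -> maps_block (A^-1)%g j i' -> i = i'.
Proof.
move=> w0_neq0 Aij Aji'; apply/eqP/negPn/negP => ii'.
have := Aji' (A (embed i w0) j) i ii'.
by rewrite -maps_block_embed // structure_groupK embed_id; move/eqP; apply/negP.
Qed.

Lemma blocks_permuted A (w0 : W) : w0 != 0 ->
  exists s : 'S_k, forall i, maps_block A i (s i).
Proof.
move=> w0_neq0.
have [s sP] := choice (fun i => maps_block_exists A i w0_neq0).
have s_inj : injective s.
  move=> i i' eq_s; have [j sj] := maps_block_exists (A^-1)%g (s i) w0_neq0.
  rewrite (maps_blockV w0_neq0 (sP i) sj); rewrite eq_s in sj.
  by rewrite (maps_blockV w0_neq0 (sP i') sj).
by exists (perm s_inj) => i; rewrite permE.
Qed.

Section BlockMap.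
Variables (A : structure_group RV) (i j : 'I_k).
Hypothesis Aij : maps_block A i j.

Definition block_fun (w : W) : W := A (embed i w) j.

Fact block_fun_is_linear : linear block_fun.
Proof. by move=> a u v; rewrite /block_fun !linearP !ffunE. Qed.

HB.instance Definition _ := GRing.isLinear.Build F W W _ block_fun block_fun_is_linear.

Fact block_fun_ker : lker (linfun block_fun) == 0%VS.
Proof.
apply/lker0P => u v; rewrite !lfunE /= => uv.
have : A (embed i u) = A (embed i v).
  by rewrite (maps_block_embed u Aij) (maps_block_embed v Aij); congr embed.
move/(congr1 (A^-1)%g); rewrite !structure_groupK => /(congr1 (fun x : V => x i)).
by rewrite !embed_id.
Qed.

Fact block_fun_preserves : preserves T (MkGL block_fun_ker).
Proof.
apply/asboolP => x y z w; rewrite !lfunE /=.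
have emb a b c d m : T a b c d = RV (embed m a) (embed m b) (embed m c) (embed m d).
  by rewrite direct_sum_form_embed !embed_id.
by rewrite (emb _ _ _ _ j) -!maps_block_embed // structure_group_preserves -emb.
Qed.

Definition block_map : structure_group T := MkStructureGroup block_fun_preserves.

Lemma block_mapE w : block_map w = A (embed i w) j.
Proof. by rewrite lfunE. Qed.

End BlockMap.

Lemma wreath_act_surj (w0 : W) : w0 != 0 ->
  forall A, exists p : wreath (structure_group T) k, wreath_act p = A.
Proof.
move=> w0_neq0 A; have [s sP] := blocks_permuted A w0_neq0.
have sVP j : maps_block A (s^-1%g j) j by rewrite -{2}(permKV s j).
exists ([ffun j => block_map (sVP j)], s).
apply: structure_group_ext => x; apply/ffunP => j.
rewrite wreath_actE /= ffunE block_mapE [in RHS](ffun_sum_embed x) linear_sum sum_ffunE.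
(* Only the block that s sends to j contributes to the component j of A x. *)
rewrite (bigD1 (s^-1%g j)) //= big1 ?addr0 // => i ij.
by apply: sP; apply: contraNneq ij => ->; rewrite permK.
Qed.

End Blocks.

Theorem corollary1p9 (R : realType) (W : vectType R) (phi : {symmetric W})
    (k : nat) (hW : (0 < \dim {:W})%N) (hphi : nondegenerate phi)
    (hk : (0 < k)%N)
    (hker : ker_form (direct_sum_form k (curvature_form phi)) = [set 0]%classic) :
  isomorphic_groups (structure_group (direct_sum_form k (curvature_form phi)))
    (wreath (structure_group (curvature_form phi)) k).
Proof.
have w0_neq0 : vpick {:W} != 0 by rewrite vpick0 -dimv_eq0 -lt0n.
apply: (isomorphic_groups_inv (@wreath_actM _ _ (curvature_form phi) k)).
  exact: wreath_act_inj w0_neq0.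
exact: (wreath_act_surj hphi hker w0_neq0).
Qed.
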